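(* Let $f,h:[a,b]\to\mathbb{R}$ be $g$-differentiable on $[a,b]$. If $|f'_g(t)|\le h'_g(t)$ for all $t\in[a,b]$ then, for each $I\in\mathcal{I}_2$, $$|f(s)-f(t)|\le|h(s)-h(t)|,\qquad s,t\in I.$$
   Context: Let $a<b$ be real numbers and let $g:\mathbb{R}\to\mathbb{R}$ be non-decreasing and left-continuous (a ''derivator''). Put $\Delta g(t)=g(t^+)-g(t)$, $D_g=\{t\in\mathbb{R}:\Delta g(t)>0\}$, and $C_g=\{t\in\mathbb{R}: g \text{ is constant on } (t-\varepsilon,t+\varepsilon)\text{ for some }\varepsilon>0\}$. The set $C_g$ is open; write $C_g=\bigcup_n (a_n,b_n)$ with $(a_n,b_n)$ its (pairwise disjoint) connected components. Put $N_g^-=\{a_n\}_n\setminus D_g$, $N_g^+=\{b_n\}_n\setminus D_g$. Standing assumption: $a\notin N_g^-$ and $b\notin N_g^+\cup D_g\cup C_g$. $g$-derivative: for $f:[a,b]\to\mathbb{R}$ and $t\in[a,b]$, $f'_g(t)=\lim_{s\to t}\frac{f(s)-f(t)}{g(s)-g(t)}$ if $t\notin D_g\cup C_g$; $f'_g(t)=\lim_{s\to t^+}\frac{f(s)-f(t)}{g(s)-g(t)}$ if $t\in D_g$; $f'_g(t)=\lim_{s\to b_n^+}\frac{f(s)-f(b_n)}{g(s)-g(b_n)}$ if $t\in(a_n,b_n)\subset C_g$; provided the limit exists (and is finite). Limits are taken over those $s\in[a,b]$ for which the denominator is nonzero. $f$ is $g$-differentiable on $[a,b]$ if $f'_g(t)$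 exists for every $t\in[a,b]$. $\mathcal{I}_2$ denotes the family of (nonempty) connected subsets of $[a,b]\setminus(C_g\cup N_g^+\cup D_g)$. *)

(* Defs.v *)
From HB Require Import structures.
From mathcomp Require Import all_boot all_order all_algebra.
From mathcomp Require Import all_classical all_reals all_analysis.
Set Implicit Arguments.
Unset Strict Implicit.
Unset Printing Implicit Defensive.
Import Order.TTheory GRing.Theory Num.Theory.
Import numFieldNormedType.Exports.
Local Open Scope classical_set_scope.
Local Open Scope ring_scope.

Definition derivator (R : realType) (g : R -> R) : Prop :=
  {homo g : x y / x <= y} /\ forall t, g s @[s --> t^'-] --> g t.

Definition gjump (R : realType) (g : R -> R) (t : R) : R :=
  lim (g s @[s --> t^'+]) - g t.

Definition Dg (R : realType) (g : R -> R) : set R := [set t | 0 < gjump g t].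

Definition Cg (R : realType) (g : R -> R) : set R :=
  [set t | exists2 e, 0 < e & exists c, forall s, t - e < s < t + e -> g s = c].

(* The endpoints are extended reals because a component of [Cg g] may be
   unbounded. *)
Definition Cg_component (R : realType) (g : R -> R) (l u : \bar R) : Prop :=
  exists2 t, Cg g t &
    connected_component (Cg g) t = [set x : R | (l < x%:E < u)%E].

Definition Ngminus (R : realType) (g : R -> R) : set R :=
  [set x : R | exists u : \bar R, Cg_component g x%:E u] `\` Dg g.

Definition Ngplus (R : realType) (g : R -> R) : set R :=
  [set x : R | exists l : \bar R, Cg_component g l x%:E] `\` Dg g.

Definition gquot (R : realType) (g f : R -> R) (t s : R) : R :=
  (f s - f t) / (g s - g t).

Definition gdom (R : realType) (a b : R) (g : R -> R) (t : R) : set R :=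
  [set s | a <= s <= b /\ g s - g t != 0].

(* Only the values of [f] on [a, b] matter when [t] is in [a, b] and [b] is
   not in [Cg g], since then the right endpoint [r] below is at most [b]. *)
Definition is_gderive (R : realType) (a b : R) (g f : R -> R) (t d : R)
    : Prop :=
  [\/ ~ (Dg g `|` Cg g) t /\
      gquot g f t s @[s --> within (gdom a b g t) (nbhs t)] --> d,
      Dg g t /\
      gquot g f t s @[s --> within (gdom a b g t) t^'+] --> d
    | exists l : \bar R, exists r : R,
      [/\ Cg_component g l r%:E, (l < t%:E < r%:E)%E &
      gquot g f r s @[s --> within (gdom a b g r) r^'+] --> d]].

Definition gdifferentiable (R : realType) (a b : R) (g f : R -> R) : Prop :=
  forall t, a <= t <= b -> exists d, is_gderive a b g f t d.

Definition gderive (R : realType) (a b : R) (g f : R -> R) (t : R) : R :=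
  xget 0 [set d | is_gderive a b g f t d].

Definition family_I2 (R : realType) (a b : R) (g : R -> R) : set (set R) :=
  [set I | [/\ I !=set0, connected I &
    I `<=` `[a, b] `\` (Cg g `|` Ngplus g `|` Dg g)]].

(* Main.v *)
Require Import Defs.
From HB Require Import structures.
From mathcomp Require Import all_boot all_order all_algebra.
From mathcomp Require Import all_classical all_reals all_analysis.
From mathcomp Require Import lra.
Import Order.TTheory GRing.Theory Num.Theory.
Import numFieldNormedType.Exports.
Local Open Scope classical_set_scope.
Local Open Scope ring_scope.

(** Inside a member of I_2 there is no interval of constancy of [g], so [g] is
strictly increasing there ([g_increasing_in_I2]), and every point falls under
the first clause of the [g]-derivative, the two-sided limit of difference
quotients.  The statement thus reduces to a mean value inequality relative to
a strictly increasing [g].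

Fix [e > 0] and call a pair [x <= y] good when
[`|f y - f x| <= h y - h x + e * (g y - g x)].  Since [`|f'_g z| <= h'_g z],
the difference quotients at [z] show that the pair formed by [z] and any point
of [I] close enough to [z] is good ([increment_le_near]).  Goodness is transitive, as
increments add up, so the local property spreads over the whole segment by a
least upper bound argument ([segment_chain]); then [e] goes to [0]. *)

(** The supremum [c] of the points that can be reached from [s] is reached,
because some reached point lies close to its left; and if [c < t] then points
slightly to its right would be reached as well. *)
Lemma segment_chain (R : realType) (P : R -> R -> Prop) (s t : R) :
  s <= t ->
  (forall x y z, P x y -> P y z -> P x z) ->
  (forall z, s <= z <= t -> \forall x \near z, s <= x <= t ->
     (x <= z -> P x z) /\ (z <= x -> P z x)) ->
  P s t.
Proof.
move=> st Ptrans Ploc.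
pose A := [set x | s <= x <= t /\ P s x].
have As : A s.
  have sst : s <= s <= t by rewrite lexx st.
  by split=> //; have [/(_ (lexx s))] := nbhs_singleton (Ploc s sst) sst.
have ubA : ubound A t by move=> x [/andP[]].
have supA : has_sup A by split; [exists s | exists t].
set c := sup A.
have sc : s <= c by apply: ub_le_sup => //; exists t.
have ct : c <= t by apply: ge_sup => //; exists s.
have cst : s <= c <= t by rewrite sc ct.
have /nbhs_ballP[d /= d0 Pd] := Ploc c cst.
have Psc : P s c.
  have [x Ax cx] := sup_adherent d0 supA.
  have xc : x <= c by apply: ub_le_sup => //; exists t.
  case: Ax => xst Psx; apply: (Ptrans _ x) => //.
  have [|/(_ xc)//] := Pd x _ xst.
  rewrite /ball /= ger0_norm ?subr_ge0 // ltrBlDr addrC -ltrBlDr; exact: cx.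
move: ct; rewrite le_eqVlt => /predU1P[<-//|ct].
pose y := Num.min t (c + d / 2).
have cy : c < y by rewrite lt_min ct ltrDl divr_gt0.
have yst : s <= y <= t by rewrite ge_min lexx (le_trans sc (ltW cy)).
have Ay : A y.
  split=> //; apply: (Ptrans _ c) => //.
  have [|_ /(_ (ltW cy))//] := Pd y _ yst.
  rewrite /ball /= distrC gtr0_norm ?subr_gt0 // ltrBlDr.
  have : y <= c + d / 2 by rewrite ge_min lexx orbT.
  by move=> /le_lt_trans; apply; rewrite addrC ltrD2r; lra.
have : y <= c by apply: ub_le_sup => //; exists t.
by rewrite leNgt cy.
Qed.

(** Near [z] each quotient is within [e / 2] of its limit.  The bound keeps the
quotient of [h] because its product with [`|g x - g z|] is [h x - h z] on the
right of [z] but [h z - h x] on its left, so one formula serves both sides. *)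
Lemma increment_le_near (R : realType) (a b : R) (g f h : R -> R)
    (z df dh e : R) :
  gquot g f z x @[x --> within (gdom a b g z) (nbhs z)] --> df ->
  gquot g h z x @[x --> within (gdom a b g z) (nbhs z)] --> dh ->
  `|df| <= dh -> 0 < e ->
  \forall x \near z, gdom a b g z x ->
    `|f x - f z| <= (gquot g h z x + e) * `|g x - g z|.
Proof.
move=> /cvgrPdist_lt cf /cvgrPdist_lt ch dfh e0.
have e20 : 0 < e / 2 by rewrite divr_gt0.
have fh : \forall x \near z, gdom a b g z x ->
    `|df - gquot g f z x| < e / 2 /\ `|dh - gquot g h z x| < e / 2.
  exact: filterI (cf _ e20) (ch _ e20).
apply: filterS fh => x + Dx => /(_ Dx)[fx hx].
have gx : g x - g z != 0 by case: Dx.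
have -> : f x - f z = gquot g f z x * (g x - g z) by rewrite /gquot divfK.
rewrite normrM ler_wpM2r // -(subrK df (gquot g f z x)).
rewrite (le_trans (ler_normD _ _)) // distrC.
by move: hx; rewrite ltr_norml => /andP[_]; lra.
Qed.

(** If [g] took the same value at two points of the interval, it would be
constant between them and their midpoint would lie in [Cg g]. *)
Lemma g_increasing_in_I2 (R : realType) (a b : R) (g : R -> R) (I : set R)
    (x y : R) :
  {homo g : x y / x <= y} -> family_I2 a b g I ->
  I x -> I y -> x < y -> g x < g y.
Proof.
move=> gmono [_ /connected_intervalP Iint IS] Ix Iy xy.
rewrite lt_neqAle gmono ?ltW // andbT; apply/eqP => gxy.
pose m := (x + y) / 2.
have /IS[_] : I m by apply: (Iint x y) => //; rewrite /m; apply/andP; split; lra.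
apply; left; left; exists ((y - x) / 2); first by rewrite divr_gt0 ?subr_gt0.
exists (g x) => u /andP[mu um]; apply/eqP; rewrite eq_le {1}gxy.
by rewrite !gmono //; move: mu um; rewrite /m; lra.
Qed.

(** A point of a component of [Cg g] is in [Cg g], so off [Dg g] and [Cg g]
only the two-sided clause of the definition can hold. *)
Lemma gderive_cvg (R : realType) (a b : R) (g f : R -> R) (t : R) :
  gdifferentiable a b g f -> a <= t <= b -> ~ (Dg g `|` Cg g) t ->
  gquot g f t s @[s --> within (gdom a b g t) (nbhs t)] --> gderive a b g f t.
Proof.
move=> fdiff tab tDC.
have /(xgetPex 0) : exists d, is_gderive a b g f t d := fdiff t tab.
rewrite -/(gderive a b g f t) /= => -[[]//|[Dt]|]; first by case: tDC; left.
case=> l [r [[u Cu compE] tlr _]]; case: tDC; right.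
by apply: (@connected_component_sub _ (Cg g) u); rewrite compE.
Qed.

Theorem theorem3p16 (R : realType) (a b : R) (g f h : R -> R)
    (hab : a < b) (hg : derivator g)
    (ha : ~ Ngminus g a)
    (hb : ~ (Ngplus g `|` Dg g `|` Cg g) b)
    (hf : gdifferentiable a b g f) (hh : gdifferentiable a b g h)
    (hfh : forall t, a <= t <= b -> `|gderive a b g f t| <= gderive a b g h t)
    (I : set R) (hI : family_I2 a b g I) (s t : R) (hs : I s) (ht : I t) :
  `|f s - f t| <= `|h s - h t|.
Proof.
wlog st : s t hs ht / s <= t.
  move=> W; have [st|/ltW ts] := leP s t; first exact: W.
  by rewrite distrC (distrC (h s)); exact: W.
have [gmono _] := hg.
have [_ /connected_intervalP Iint IS] := hI.
have stI z : s <= z <= t -> I z by exact: Iint.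
suff main e : 0 < e -> `|f t - f s| <= h t - h s + e * (g t - g s).
  rewrite distrC (distrC (h s)); apply: le_trans (ler_norm _).
  apply/ler_addgt0Pr => e e0.
  have gst : 0 <= g t - g s by rewrite subr_ge0 gmono.
  (* the denominator is shifted by 1 to cover the case s = t *)
  apply: (le_trans (main (e / (g t - g s + 1)) _)); first by rewrite divr_gt0 //; lra.
  rewrite lerD2l mulrAC ler_pdivrMr; last by lra.
  by rewrite ler_pM2l //; lra.
move=> e0.
apply: (@segment_chain _
  (fun x y => `|f y - f x| <= h y - h x + e * (g y - g x)) s t) => //.
  move=> x y z xy yz; rewrite -(subrKA (f y)).
  by apply: (le_trans (ler_normD _ _)); lra.
move=> z zst.
have /IS[/= zab zN] := stI z zst.
have zDC : ~ (Dg g `|` Cg g) z.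
  by move=> [Dz|Cz]; apply: zN; [right|left; left].
have zab' : a <= z <= b by move: zab; rewrite in_itv.
have := increment_le_near _ _ _ _ _ _ _ _ _ _ (gderive_cvg _ _ _ _ _ _ hf zab' zDC) (gderive_cvg _ _ _ _ _ _ hh zab' zDC)
  (hfh z zab') e0.
apply: filterS => x xz xst.
have /IS[/= + _] := stI x xst; rewrite in_itv /= => xab.
have [xltz|zltx|->] := ltgtP x z; last first.
- by split=> _; rewrite !subrr normr0 mulr0 addr0.
- have gzx := g_increasing_in_I2 _ _ _ _ _ _ _ gmono hI (stI _ zst) (stI _ xst) zltx.
  have gne : g x - g z != 0 by rewrite subr_eq0 gt_eqF.
  split=> // _; have := xz (conj xab gne).
  by rewrite (gtr0_norm (x := g x - _)) ?subr_gt0 // mulrDl /gquot divfK.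
- have gxz := g_increasing_in_I2 _ _ _ _ _ _ _ gmono hI (stI _ xst) (stI _ zst) xltz.
  have gne : g x - g z != 0 by rewrite subr_eq0 lt_eqF.
  split=> // _; have := xz (conj xab gne).
  rewrite (ltr0_norm (x := g x - _)) ?subr_lt0 // mulrDl mulrN /gquot divfK // distrC.
  by rewrite !opprB.
Qed.
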